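(* Let $\alpha,\beta\in\mathbb{C}$ and let $(t_n)_{n\in\mathbb{Z}}$ be a complex sequence with nonzero terms satisfying the Somos-4 equation $$t_nt_{n+4}=\alpha\,t_{n+1}t_{n+3}+\beta\,t_{n+2}^2\qquad (n\in\mathbb{Z}).$$ Let $(W_n)_{n\in\mathbb{Z}}$ be its companion elliptic sequence. Then for all $(N,p,q,n)\in\mathbb{Z}^4$, $$W_{q-p}W_{N-p-q}\,t_nt_{n+N}=W_qW_{N-q}\,t_{n+p}t_{n+N-p}-W_pW_{N-p}\,t_{n+q}t_{n+N-q}.$$
   Context: Definition of the companion elliptic sequence. Put $$H=\frac{t_0t_3}{t_1t_2}+\alpha\frac{t_1^2}{t_0t_2}+\alpha\frac{t_2^2}{t_1t_3}+\beta\frac{t_1t_2}{t_0t_3},\qquad \mathcal{I}=\alpha^2+\beta H$$ ($H$ is a first integral: the same expression with all indices shifted by $n$ has the same value). Fix a square root $\sqrt\alpha$. Then $$W_0=0,\quad W_1=1,\quad W_2=\sqrt\alpha,\quad W_3=-\beta,\quad W_4=-\mathcal{I}\sqrt\alpha,$$ and the remaining terms are determined by the recurrence $$W_nW_{n+4}=W_2^2W_{n+1}W_{n+3}-W_1W_3W_{n+2}^2$$ together with $W_{-n}=-W_n$. The recurrence is solved for $W_{n+4}$ with $\sqrt\alpha,\beta,\mathcal{I}$ treated as indeterminates; the $W_n$ are polynomials in these. For example, with $\mathcal{J}=\alpha^2\mathcal{I}-\beta^3$: $W_5=-\mathcal{J}$, $W_6=\beta(\mathcal{I}^2+\mathcal{J})\sqrt\alpha$,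 $W_7=\alpha^2\mathcal{I}^3+\beta^3\mathcal{J}$, $W_8=(\mathcal{J}^2-\beta^3(\mathcal{I}^2+\mathcal{J}))\mathcal{I}\sqrt\alpha$. Equivalent analytic description: the general solution of the Somos-4 equation is known to have the form $t_n=AB^n\sigma(z_0+n\kappa)/\sigma(\kappa)^{n^2}$ for suitable constants $A,B,z_0,\kappa$ and the Weierstrass sigma function $\sigma(z)=\sigma(z;g_2,g_3)$ of a suitable elliptic curve $y^2=4x^3-g_2x-g_3$, and in terms of this representation $W_n=\sigma(n\kappa)/\sigma(\kappa)^{n^2}$. *)

(* Defs.v *)
From HB Require Import structures.
From mathcomp Require Import all_boot all_order all_algebra.
From mathcomp Require Import fraction mpoly.
From mathcomp Require Import reals complex.
From Stdlib Require Import ClassicalEpsilon.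

Set Implicit Arguments.
Unset Strict Implicit.
Unset Printing Implicit Defensive.

Import Order.TTheory GRing.Theory Num.Theory.
Local Open Scope ring_scope.

Definition somos4 (F : fieldType) (alpha beta : F) (t : int -> F) : Prop :=
  forall n : int,
    t n * t (n + 4) = alpha * t (n + 1) * t (n + 3) + beta * t (n + 2) ^+ 2.

Definition first_integral (F : fieldType) (alpha beta : F) (t : int -> F) : F :=
  t 0 * t 3 / (t 1 * t 2) + alpha * (t 1 ^+ 2 / (t 0 * t 2))
  + alpha * (t 2 ^+ 2 / (t 1 * t 3)) + beta * (t 1 * t 2 / (t 0 * t 3)).

Definition companion_I (F : fieldType) (alpha beta : F) (t : int -> F) : F :=
  alpha ^+ 2 + beta * first_integral alpha beta t.

(* The last branch computes W_(m+4) for m >= 1, with m1 = m+1, m2 = m+2 and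
   m3 = m+3. *)
Fixpoint edseq_nat (K : fieldType) (w1 w2 w3 w4 : K) (n : nat) {struct n} : K :=
  match n with
  | 0 => 0
  | 1 => w1
  | 2 => w2
  | 3 => w3
  | 4 => w4
  | (((m.+1 as m1).+1 as m2).+1 as m3).+1 =>
      (w2 ^+ 2 * edseq_nat w1 w2 w3 w4 m1 * edseq_nat w1 w2 w3 w4 m3
       - w1 * w3 * edseq_nat w1 w2 w3 w4 m2 ^+ 2) / edseq_nat w1 w2 w3 w4 m
  end.

Definition edseq (K : fieldType) (w1 w2 w3 w4 : K) (n : int) : K :=
  match n with
  | Posz m => edseq_nat w1 w2 w3 w4 m
  | Negz m => - edseq_nat w1 w2 w3 w4 m.+1
  end.

(* The indeterminates 'X_0, 'X_1, 'X_2 stand for sqrt alpha, beta and I.  The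
   division in the recurrence takes place in the fraction field of the
   polynomial ring, because W_n can vanish at particular complex values. *)
Definition generic_companion (F : fieldType) : int -> {fraction {mpoly F[3]}} :=
  let s : {mpoly F[3]} := 'X_0 in
  let b : {mpoly F[3]} := 'X_1 in
  let i : {mpoly F[3]} := 'X_2 in
  edseq 1 (tofrac s) (tofrac (- b)) (tofrac (- (i * s))).

(* tofrac is injective, so at most one polynomial represents a given term. *)
Definition companion_poly (F : fieldType) (n : int) : {mpoly F[3]} :=
  epsilon (inhabits 0) (fun P => tofrac P = generic_companion F n).

Definition companion (F : fieldType) (s alpha beta : F) (t : int -> F) (n : int)
    : F :=
  (companion_poly F n).@[tnth [tuple s; beta; companion_I alpha beta t]].

(* Main.v *)
Require Import Defs.
From mathcomp Require Import all_boot all_order all_algebra.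
From mathcomp Require Import fraction mpoly.
From mathcomp Require Import reals complex.
From mathcomp Require Import ring zify.
From Stdlib Require Import ClassicalEpsilon.

Set Implicit Arguments.
Unset Strict Implicit.
Unset Printing Implicit Defensive.

Import Order.TTheory GRing.Theory Num.Theory.
Local Open Scope ring_scope.
Local Open Scope complex_scope.

(** Write [W_k = V_k] for odd [k] and [W_k = sqrt alpha * V_k] for even [k].
    Comparing products of four terms of [t] grouped in two ways gives, by a
    simultaneous induction on [m], the two addition formulas
      [t_(a-m) t_(a+m) = W_m^2 t_(a-1) t_(a+1) - W_(m-1) W_(m+1) t_a^2],
      [t_(a-m) t_(a+m+1) = V_m V_(m+1) t_(a-1) t_(a+2)
                           - V_(m-1) V_(m+2) t_a t_(a+1)];
    the induction divides only by terms of [t], and it uses that [t] and [W]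
    satisfy the Somos-4 relation with the same first integral [H].  Passing
    from [W] to [V] removes the division by [sqrt alpha], which may vanish.
    Both formulas express a product as a 2 x 2 determinant, so the three-term
    identity is a Plücker relation, according to the parity of [N].

    Over the field of fractions of the polynomial ring, [W] has no zero term of
    positive index, because [W_k] specializes to [k] at
    [(sqrt alpha, beta, I) = (2, -3, -2)].  Hence [W] satisfies its own addition
    formulas; these imply the duplication formulas, which show that the [V_k]
    are polynomials, and all identities specialize. *)

(** * Addition formulas for Somos-4 sequences indexed by naturals *)

(* The Somos-4 relation with first integral [H].  For [c] constant equal to
   [alpha] it is the relation satisfied by [W]; dividing the terms of even
   index by [sqrt alpha] turns this constant into the 2-periodic [c] with
   values [alpha ^+ 2] (even) and [1] (odd). *)
Definition somos4_int (K : pzRingType) (c : nat -> K) (beta H : K)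
    (u : nat -> K) :=
  forall k,
    u k * u k.+4 = c k.+1 * u k.+1 * u k.+3 + beta * u k.+2 ^+ 2 /\
    u k * u k.+3 ^+ 2 + u k.+1 ^+ 2 * u k.+4 + c k * u k.+2 ^+ 3
      = H * u k.+1 * u k.+2 * u k.+3.

(** With [a] equal to sqrt alpha this is the factor between V_k and W_k; with [a] equal to alpha,
    its square is the 2-periodic coefficient in the relation for V. *)
Definition even_factor (K : pzRingType) (a : K) (k : nat) : K :=
  if odd k then 1 else a.

Lemma even_factorS2 (K : pzRingType) (a : K) k :
  even_factor a k.+2 = even_factor a k.
Proof. by rewrite /even_factor /= negbK. Qed.

Lemma even_factorMS (K : comPzRingType) (a : K) k :
  even_factor a k * even_factor a k.+1 = a.
Proof. by rewrite /even_factor /=; case: (odd k); rewrite ?mul1r ?mulr1. Qed.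

(** The left factors are neighbouring odd-type determinants of rank m; the right ones are even-type,
    of rank m+1 (wanted) and m (known). *)
Lemma addition_step_even (K : comNzRingType)
    (e0 e1 beta H v0 v1 v2 v3 v4 x0 x1 x2 x3 x4 : K) :
  v0 * v4 = e1 ^+ 2 * v1 * v3 + beta * v2 ^+ 2 ->
  v0 * v3 ^+ 2 + v1 ^+ 2 * v4 + e0 ^+ 2 * v2 ^+ 3 = H * v1 * v2 * v3 ->
  x0 * x4 = e0 * e1 * x1 * x3 + beta * x2 ^+ 2 ->
  x0 * x3 ^+ 2 + x1 ^+ 2 * x4 + e0 * e1 * x2 ^+ 3 = H * x1 * x2 * x3 ->
  (v1 * v2 * (x0 * x3) - v0 * v3 * (x1 * x2))
  * (v1 * v2 * (x1 * x4) - v0 * v3 * (x2 * x3))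
  = (e0 * v2 ^+ 2 * (x1 * x3) - e1 * (v1 * v3) * x2 ^+ 2)
    * (e1 * v1 ^+ 2 * (x1 * x3) - e0 * (v0 * v2) * x2 ^+ 2).
Proof.
move=> /eqP; rewrite -subr_eq0 => /eqP rv1 /eqP; rewrite -subr_eq0 => /eqP rv2.
move=> /eqP; rewrite -subr_eq0 => /eqP rx1 /eqP; rewrite -subr_eq0 => /eqP rx2.
apply/eqP; rewrite -subr_eq0; apply/eqP.
(* The zeros stand, in order, for [rx1], [rx2], [rv2], [rv1]: the difference of the two sides is
   this combination of the four relations. *)
transitivity ((v1 * v2) ^+ 2 * (x1 * x3) * 0 - v1 * v2 * (v0 * v3) * x2 * 0
  + (x1 * x3) * x2 ^+ 2 * (v0 * 0 - v1 ^+ 2 * 0) : K); last by ring.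
rewrite -{1}rx1 -{1}rx2 -{1}rv2 -{1}rv1; ring.
Qed.

(** Here two neighbouring even-type determinants of rank m+1 give the product of the odd-type ones
    of ranks m+1 and m. *)
Lemma addition_step_odd (K : comNzRingType)
    (e0 e1 beta H v0 v1 v2 v3 v4 x0 x1 x2 x3 x4 : K) :
  v0 * v4 = e1 ^+ 2 * v1 * v3 + beta * v2 ^+ 2 ->
  v0 * v3 ^+ 2 + v1 ^+ 2 * v4 + e0 ^+ 2 * v2 ^+ 3 = H * v1 * v2 * v3 ->
  x0 * x4 = e0 * e1 * x1 * x3 + beta * x2 ^+ 2 ->
  x0 * x3 ^+ 2 + x1 ^+ 2 * x4 + e0 * e1 * x2 ^+ 3 = H * x1 * x2 * x3 ->
  (e0 * v2 ^+ 2 * (x0 * x2) - e1 * (v1 * v3) * x1 ^+ 2)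
  * (e0 * v2 ^+ 2 * (x1 * x3) - e1 * (v1 * v3) * x2 ^+ 2)
  = (v2 * v3 * (x0 * x3) - v1 * v4 * (x1 * x2))
    * (v1 * v2 * (x0 * x3) - v0 * v3 * (x1 * x2)).
Proof.
move=> /eqP; rewrite -subr_eq0 => /eqP rv1 /eqP; rewrite -subr_eq0 => /eqP rv2.
move=> /eqP; rewrite -subr_eq0 => /eqP rx1 /eqP; rewrite -subr_eq0 => /eqP rx2.
apply/esym/eqP; rewrite -subr_eq0; apply/eqP.
(* The zeros stand, in order, for [rx2], [rx1], [rv2], [rv1]. *)
transitivity (v1 * v2 ^+ 2 * v3 * (x0 * 0 - x1 ^+ 2 * 0)
  - x0 * x1 * x2 * x3 * v2 * 0 + x1 ^+ 2 * x2 ^+ 2 * v1 * v3 * 0 : K);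
  last by ring.
rewrite -{1}rx2 -{1}rx1 -{1}rv2 -{1}rv1; ring.
Qed.

(** Here [j] is the smallest index and [m.+1] is the distance called m in the overview, so the case
    [m = 0] is immediate. *)
Lemma somos4_addition (K : fieldType) (alpha beta H : K) (u v : nat -> K) :
    (forall k, u k != 0) ->
    somos4_int (fun=> alpha) beta H u ->
    v 0%N = 0 -> v 1%N = 1 -> v 2%N = 1 ->
    somos4_int (fun k => even_factor alpha k ^+ 2) beta H v ->
  forall m j,
    u j * u (j + m.*2.+2)%N
      = even_factor alpha m.+1 * v m.+1 ^+ 2 * (u (j + m)%N * u (j + m).+2)
        - even_factor alpha m * (v m * v m.+2) * u (j + m).+1 ^+ 2 /\
    u j * u (j + m.*2.+3)%N
      = v m.+1 * v m.+2 * (u (j + m)%N * u (j + m).+3)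
        - v m * v m.+3 * (u (j + m).+1 * u (j + m).+2).
Proof.
move=> u0 hu v0 v1 v2 hv; elim=> [|m IHm] j.
  rewrite v0 v1 v2 !addn0 /even_factor /= !addnS !addn0; split; ring.
pose e := even_factor alpha m; pose e' := even_factor alpha m.+1.
have alphaE : alpha = e * e' by rewrite even_factorMS.
have [hv1 hv2] := hv m.
have {}hu k : u k * u k.+4 = e * e' * u k.+1 * u k.+3 + beta * u k.+2 ^+ 2 /\
    u k * u k.+3 ^+ 2 + u k.+1 ^+ 2 * u k.+4 + e * e' * u k.+2 ^+ 3
      = H * u k.+1 * u k.+2 * u k.+3.
  by rewrite -alphaE.
(* Proved at every position, since the odd formula of the same rank uses it at [j] and [j.+1]. *)
have even_case k : u k * u (k + m.+1.*2.+2)%N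
    = e * v m.+2 ^+ 2 * (u (k + m).+1 * u (k + m).+3)
      - e' * (v m.+1 * v m.+3) * u (k + m).+2 ^+ 2.
  have nz : u k.+1 * u (k.+1 + m.*2.+2)%N != 0 by rewrite mulf_neq0.
  have [_ So] := IHm k; have [Te So1] := IHm k.+1.
  apply: (mulIf nz).
  transitivity ((u k * u (k + m.*2.+3)%N) * (u k.+1 * u (k.+1 + m.*2.+3)%N)).
    rewrite doubleS !addnS !addSn; ring.
  rewrite So So1 Te !addSn; have [hu1 hu2] := hu (k + m)%N.
  exact: addition_step_even hv1 hv2 hu1 hu2.
rewrite -![(j + m.+1)%N]addSnnS !addSn even_factorS2 -/e -/e'.
split; first by rewrite even_case.
have nz : u j.+1 * u (j.+1 + m.*2.+3)%N != 0 by rewrite mulf_neq0.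
apply: (mulIf nz).
transitivity ((u j * u (j + m.+1.*2.+2)%N)
              * (u j.+1 * u (j.+1 + m.+1.*2.+2)%N)).
  rewrite doubleS !addnS !addSn; ring.
rewrite !even_case; have [_ ->] := IHm j.+1; rewrite !addSn.
have [hu1 hu2] := hu (j + m).+1.
exact: addition_step_odd hv1 hv2 hu1 hu2.
Qed.

(** * The first integral and the companion sequence over a field *)

(** The cubic relation is the first integral with denominators cleared and beta absorbed by the
    recurrence. Its defect passes to the next index with factors [x4] and [x1], so vanishing
    propagates both ways where these are nonzero. *)
Lemma integral_shift (K : comNzRingType) (alpha beta H x0 x1 x2 x3 x4 x5 : K) :
  x0 * x4 = alpha * x1 * x3 + beta * x2 ^+ 2 ->
  x1 * x5 = alpha * x2 * x4 + beta * x3 ^+ 2 ->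
  x4 * (x0 * x3 ^+ 2 + x1 ^+ 2 * x4 + alpha * x2 ^+ 3 - H * x1 * x2 * x3)
  = x1 * (x1 * x4 ^+ 2 + x2 ^+ 2 * x5 + alpha * x3 ^+ 3 - H * x2 * x3 * x4).
Proof.
move=> r0 r1.
transitivity (x3 ^+ 2 * (x0 * x4) + x1 ^+ 2 * x4 ^+ 2 + alpha * x2 ^+ 3 * x4
  - H * x1 * x2 * x3 * x4); first by ring.
transitivity (x1 ^+ 2 * x4 ^+ 2 + x2 ^+ 2 * (x1 * x5) + alpha * x1 * x3 ^+ 3
  - H * x1 * x2 * x3 * x4); last by ring.
rewrite r0 r1; ring.
Qed.

Lemma somos4_int_of_init (K : fieldType) (alpha beta H : K) (w : nat -> K) :
    (forall k, w k.+1 != 0) ->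
    (forall k, w k * w k.+4 = alpha * w k.+1 * w k.+3 + beta * w k.+2 ^+ 2) ->
    w 0%N * w 3%N ^+ 2 + w 1%N ^+ 2 * w 4%N + alpha * w 2%N ^+ 3
      = H * w 1%N * w 2%N * w 3%N ->
  somos4_int (fun=> alpha) beta H w.
Proof.
move=> w0 hw init k; split; first exact: hw.
elim: k => [|k IHk] //.
apply/eqP; rewrite -subr_eq0 -(mulrI_eq0 _ (mulfI (w0 k))).
by rewrite -(integral_shift _ (hw k) (hw k.+1)) IHk subrr mulr0.
Qed.

(** The formulas of [somos4_addition] for W itself, with [u k] taken as W_(k+1) to avoid the zero at
    index 0. *)
Definition eds_addition (K : pzRingType) (s : K) (v : nat -> K) :=
  let w k := even_factor s k * v k in
  forall m j,
    w j.+1 * w (j + m.*2.+3)%N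
      = w m.+1 ^+ 2 * (w (j + m).+1 * w (j + m).+3)
        - w m * w m.+2 * w (j + m).+2 ^+ 2 /\
    v j.+1 * v (j + m.*2.+4)%N
      = v m.+1 * v m.+2 * (v (j + m).+1 * v (j + m).+4)
        - v m * v m.+3 * (v (j + m).+2 * v (j + m).+3).

Lemma even_factor_exp (K : pzRingType) (a : K) n k :
  even_factor (a ^+ n) k = even_factor a k ^+ n.
Proof. by rewrite /even_factor; case: odd; rewrite ?expr1n. Qed.

Lemma rmorph_even_factor (A K : pzRingType) (f : {rmorphism A -> K}) (a : A) k :
  even_factor (f a) k = f (even_factor a k).
Proof. by rewrite /even_factor; case: odd; rewrite ?rmorph1. Qed.

Lemma even_factor_neq0 (K : fieldType) (a : K) k :
  a != 0 -> even_factor a k != 0.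
Proof. by rewrite /even_factor; case: odd; rewrite ?oner_neq0. Qed.

Lemma somos4_int_even_factor (K : fieldType) (s beta H : K) (v : nat -> K) :
    s != 0 ->
    somos4_int (fun=> s ^+ 2) beta H (fun k => even_factor s k * v k) ->
  somos4_int (fun k => even_factor (s ^+ 2) k ^+ 2) beta H v.
Proof.
move=> s0 hw k; have [] := hw k.
rewrite !even_factor_exp !even_factorS2; have := even_factorMS s k.
have := even_factor_neq0 k s0; have := even_factor_neq0 k.+1 s0.
(* Terms of equal parity share a factor [p] or [q], so the two relations are divided by p^2 and p
   q^2. *)
set p := even_factor s k; set q := even_factor s k.+1 => q0 p0 <- h1 h2.
split.
  have nz : p ^+ 2 != 0 by rewrite expf_neq0.
  apply: (mulfI nz); transitivity (p * v k * (p * v k.+4)); first by ring.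
  rewrite h1; ring.
have nz : p * q ^+ 2 != 0 by rewrite mulf_neq0 ?expf_neq0.
apply: (mulfI nz).
transitivity (p * v k * (q * v k.+3) ^+ 2 + (q * v k.+1) ^+ 2 * (p * v k.+4)
  + (p * q) ^+ 2 * (p * v k.+2) ^+ 3); first by ring.
rewrite h2; ring.
Qed.

Lemma edseq_nat_rec (K : fieldType) (w1 w2 w3 w4 : K) k :
  edseq_nat w1 w2 w3 w4 k.+4.+1
  = (w2 ^+ 2 * edseq_nat w1 w2 w3 w4 k.+2 * edseq_nat w1 w2 w3 w4 k.+4
     - w1 * w3 * edseq_nat w1 w2 w3 w4 k.+3 ^+ 2) / edseq_nat w1 w2 w3 w4 k.+1.
Proof. by []. Qed.

(** The initial values 0, 1, s, -b, -is force this [H]. *)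
Lemma companion_somos4_int (K : fieldType) (s b i : K) (v : nat -> K) :
    let w := edseq_nat 1 s (- b) (- (i * s)) in
    (forall k, w k.+1 != 0) -> s != 0 -> b != 0 ->
    (forall k, w k = even_factor s k * v k) ->
  let H := (i - s ^+ 4) / b in
  somos4_int (fun k => even_factor (s ^+ 2) k ^+ 2) b H v /\ eds_addition s v.
Proof.
move=> w w0 s0 b0 wv H.
have hw : somos4_int (fun=> s ^+ 2) b H w.
  apply: somos4_int_of_init => // [[|k]|].
  (* The recurrence defines terms from index 5 on; the relation at index 0 is checked on the initial
     values. *)
  - by rewrite /w /=; ring.
  - by rewrite /w edseq_nat_rec -/w mulrC divfK ?w0 //; ring.
  by rewrite /w /H /=; field.
have hv : somos4_int (fun k => even_factor (s ^+ 2) k ^+ 2) b H v.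
  apply: somos4_int_even_factor => // k.
  by rewrite -!wv; exact: hw.
split=> // W m j; rewrite {}/W -!wv.
have v0 : v 0%N = 0.
  by apply: (mulfI s0); have := wv 0%N; rewrite /w /= mulr0 => <-.
have v1 : v 1%N = 1.
  by have := wv 1%N; rewrite /w /even_factor /= mul1r => <-.
have v2 : v 2%N = 1.
  by apply: (mulfI s0); have := wv 2%N; rewrite /w /= mulr1 => <-.
have hu : somos4_int (fun=> s ^+ 2) b H (fun k => w k.+1).
  by move=> k; exact: hw.
have [] := somos4_addition (fun k => w0 k) hu v0 v1 v2 hv m j.
rewrite !even_factor_exp -[(j + _.+2).+1]addnS -[(j + _.+3).+1]addnS => -> h.
split; first by rewrite !wv !even_factorS2; ring.
apply: (mulfI s0).
have e2m : even_factor s (j + m.*2.+4)%N = even_factor s j.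
  by rewrite /even_factor oddD /= !negbK odd_double addbF.
transitivity (w j.+1 * w (j + m.*2.+4)%N).
  by rewrite !wv e2m -[X in X * _ = _](even_factorMS s j); ring.
have es := even_factorMS s (j + m).
by rewrite h !wv !even_factorS2 -[X in _ = X * _]es; ring.
Qed.

(** * Nonvanishing of the generic companion sequence *)

(** Evaluation is defined on [A] only, so each term is carried as a fraction P/Q whose denominator
    has nonzero value. The values persist because 4(k+1)(k+3) - 3(k+2)^2 = k(k+4), and k > 0 is
    invertible in characteristic zero. *)
Lemma edseq_nat_fraction (A : comNzRingType) (K : fieldType) (F : numFieldType)
    (f : {rmorphism A -> K}) (ev : {rmorphism A -> F}) (s b i : A) :
    injective f -> ev s = 2 -> ev b = - 3 -> ev i = - 2 ->
  forall k, exists P Q : A,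
    [/\ ev Q != 0, ev P = k%:R * ev Q
      & edseq_nat 1 (f s) (- f b) (- (f i * f s)) k * f Q = f P].
Proof.
move=> f_inj evs evb evi; set w := edseq_nat _ _ _ _.
elim/ltn_ind=> -[|[|[|[|[|k]]]]] IHk.
- by exists 0, 1; rewrite /w !(rmorph0, rmorph1) oner_neq0 !mul0r.
- by exists 1, 1; rewrite /w !(rmorph0, rmorph1) oner_neq0 !mulr1.
- by exists s, 1; rewrite /w !(rmorph0, rmorph1) oner_neq0 !mulr1.
- by exists (- b), 1; rewrite /w !(rmorphN, rmorph1) evb opprK oner_neq0 !mulr1.
- exists (- (i * s)), 1; rewrite /w !(rmorphN, rmorphM, rmorph1) /= evs evi.
  by rewrite oner_neq0; split=> //; ring.
have [P1 [Q1 [q1 p1 w1]]] := IHk k.+1 ltac:(lia).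
have [P2 [Q2 [q2 p2 w2]]] := IHk k.+2 ltac:(lia).
have [P3 [Q3 [q3 p3 w3]]] := IHk k.+3 ltac:(lia).
have [P4 [Q4 [q4 p4 w4]]] := IHk k.+4 ltac:(lia).
have evP1 : ev P1 != 0 by rewrite p1 mulf_neq0 // pnatr_eq0.
have fP1 : f P1 != 0.
  apply: contra_neq evP1; rewrite -(rmorph0 f) => /f_inj ->.
  by rewrite rmorph0.
have w10 : w k.+1 != 0 by apply: contra_neq fP1 => wk; rewrite -w1 wk mul0r.
(* The recurrence with denominators cleared; dividing by the earlier term puts [P1] in the
   denominator. *)
exists (Q1 * (s ^+ 2 * P2 * P4 * Q3 ^+ 2 + b * P3 ^+ 2 * Q2 * Q4)).
exists (P1 * (Q2 * Q4 * Q3 ^+ 2)).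
split.
- by rewrite !(rmorphM, rmorphXn) /= !mulf_neq0 ?expf_neq0.
- rewrite !(rmorphM, rmorphXn, rmorphD) /= p1 p2 p3 p4 evs evb; ring.
rewrite !(rmorphM, rmorphXn, rmorphD) /= -w1 -w2 -w3 -w4 /w edseq_nat_rec -/w.
by field.
Qed.

Lemma edseq_nat_neq0 (A : comNzRingType) (K : fieldType) (F : numFieldType)
    (f : {rmorphism A -> K}) (ev : {rmorphism A -> F}) (s b i : A) :
    injective f -> ev s = 2 -> ev b = - 3 -> ev i = - 2 ->
  forall k, edseq_nat 1 (f s) (- f b) (- (f i * f s)) k.+1 != 0.
Proof.
move=> f_inj evs evb evi k.
have [P [Q [q0 pq wk]]] := edseq_nat_fraction f_inj evs evb evi k.+1.
apply/eqP => wk0; move: wk; rewrite wk0 mul0r -(rmorph0 f) => /f_inj P0.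
move: pq; rewrite -P0 rmorph0 => /esym/eqP.
by rewrite mulf_eq0 pnatr_eq0 (negPf q0).
Qed.

(** * Integrality of V and transfer along ring morphisms *)

(** At [j = 0] the left-hand cofactor is v_1 = 1, so the addition formulas become division-free
    duplication formulas. *)
Lemma eds_addition_integral (A : pzRingType) (K : pzRingType)
    (f : {rmorphism A -> K}) (s : A) (v : nat -> K) :
    eds_addition (f s) v ->
    (forall k, (k < 5)%N -> exists P, f P = v k) -> v 1%N = 1 -> v 2%N = 1 ->
  forall k, exists P, f P = v k.
Proof.
move=> hv init v1 v2; elim/ltn_ind=> k IHk.
have [/init //|k5] := ltnP k 5.
have efE := rmorph_even_factor f s.
(* Positivity of [m] gives m+3 < 2m+3 and m+4 < 2m+4, so the induction hypothesis covers every term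
   used. *)
have [m [m0 km]] : exists m, (0 < m)%N /\ (k = m.*2.+3 \/ k = m.*2.+4)%N.
  by exists (k - 3)./2; lia.
have [P0 p0] := IHk m ltac:(lia); have [P1 p1] := IHk m.+1 ltac:(lia).
have [P2 p2] := IHk m.+2 ltac:(lia); have [P3 p3] := IHk m.+3 ltac:(lia).
have [] := hv m 0%N; rewrite !add0n v1 mulr1 => he ho.
case: km => km.
  pose W n (P : A) := even_factor s n * P.
  exists (W m.+1 P1 ^+ 2 * (W m.+1 P1 * W m.+3 P3)
          - W m P0 * W m.+2 P2 * W m.+2 P2 ^+ 2).
  have ek : even_factor (f s) k = 1.
    by rewrite km /even_factor /= negbK odd_double.
  move: he; rewrite -km ek !mul1r => ->.
  by rewrite !(rmorphB, rmorphM, rmorphXn) /= p0 p1 p2 p3 !efE.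
have [P4 p4] := IHk m.+4 ltac:(lia).
exists (P1 * P2 * (P1 * P4) - P0 * P3 * (P2 * P3)).
move: ho; rewrite mul1r -km => ->.
by rewrite !(rmorphB, rmorphM) /= p0 p1 p2 p3 p4.
Qed.

Lemma eds_addition_inj (A : pzRingType) (K : pzRingType)
    (f : {rmorphism A -> K}) (s : A) (q : nat -> A) (v : nat -> K) :
    injective f -> (forall k, f (q k) = v k) ->
  eds_addition (f s) v -> eds_addition s q.
Proof.
move=> f_inj fq hv W m j.
have efE := rmorph_even_factor f s.
by have [he ho] := hv m j; split; apply: f_inj;
  rewrite /W !(rmorphB, rmorphM, rmorphXn) /= !fq -?efE.
Qed.

Lemma eds_addition_morph (A : pzRingType) (K : pzRingType)
    (f : {rmorphism A -> K}) (s : A) (q : nat -> A) :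
  eds_addition s q -> eds_addition (f s) (f \o q).
Proof.
move=> hq W m j.
have efE := rmorph_even_factor f s.
by have [/(congr1 f) he /(congr1 f) ho] := hq m j;
  rewrite /W /= !efE; move: he ho; rewrite !(rmorphB, rmorphM, rmorphXn).
Qed.

(** * Addition formulas for the companion at integer indices *)

Definition odd_ext (K : zmodType) (v : nat -> K) (x : int) : K :=
  match x with Posz n => v n | Negz n => - v n.+1 end.

Lemma odd_extN (K : zmodType) (v : nat -> K) (x : int) :
  v 0%N = 0 -> odd_ext v (- x) = - odd_ext v x.
Proof. by case: x => [[|n]|n] v0; rewrite /= ?v0 ?oppr0 ?opprK. Qed.

Lemma odd_ext_even_factor (K : pzRingType) (s : K) (v : nat -> K) (x : int) :
  odd_ext (fun k => even_factor s k * v k) x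
  = even_factor s `|x|%N * odd_ext v x.
Proof. by case: x => n //=; rewrite mulrN. Qed.

Lemma even_factorM (K : comPzRingType) (s : K) k l :
  odd (k + l) -> even_factor s k * even_factor s l = s.
Proof.
by rewrite oddD /even_factor; do 2 case: odd => //; rewrite ?mul1r ?mulr1.
Qed.

(** Exchanging the arguments and reflecting about -e/2 reduce everything to C > D > 0. The even
    formula has [e = 0]; the odd one, centred at C + 1/2, has [e = 1]. *)
Lemma reflection_ind (e : nat) (P : int -> int -> Prop) :
    (e <= 1)%N ->
    (forall C D, P C D -> P D C) ->
    (forall C D, P C D -> P (- e%:Z - C) D) ->
    (forall C, P C C) -> (forall C, P C 0) ->
    (forall m j : nat, P (j + m).+2 m.+1) ->
  forall C D, P C D.
Proof.
move=> e1 swap refl diag P0 Pnat.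
have nat_case (c d : nat) : P c d.
  wlog dc : c d / (d <= c)%N.
    by move=> wl; have [/wl //|/ltnW/wl/swap] := leqP d c.
  case: d dc => [|d]; first by move=> _; exact: P0.
  rewrite leq_eqVlt => /orP[/eqP->|dc]; first exact: diag.
  by have := Pnat d (c - d.+2)%N; congr P; lia.
have int_nat C (d : nat) : P C d.
  case: C => c; first exact: nat_case.
  by have := refl _ _ (nat_case (c.+1 - e)%N d); congr P; lia.
move=> C [] d; first exact: int_nat.
by have := refl _ _ (swap _ _ (int_nat C (d.+1 - e)%N)) => /swap; congr P; lia.
Qed.

Lemma eds_addition_even (K : comPzRingType) (s : K) (v : nat -> K) :
    let W := odd_ext (fun k => even_factor s k * v k) in
    v 0%N = 0 -> v 1%N = 1 -> eds_addition s v ->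
  forall C D : int,
    W (C + D) * W (C - D)
    = W D ^+ 2 * (W (C + 1) * W (C - 1)) - W (D + 1) * W (D - 1) * W C ^+ 2.
Proof.
move=> W v0 v1 hv.
have WN x : W (- x) = - W x by apply: odd_extN; rewrite v0 mulr0.
have W0 : W 0 = 0 by rewrite /W /= v0 mulr0.
have W1 : W 1 = 1 by rewrite /W /= v1 mulr1.
apply: (@reflection_ind 0) => //.
- move=> C D h; rewrite -(opprB C D) WN mulrN addrC h; ring.
- move=> C D; rewrite oppr0 sub0r.
  have -> : - C + D = - (C - D) by ring.
  have -> : - C - D = - (C + D) by ring.
  have -> : - C + 1 = - (C - 1) by ring.
  have -> : - C - 1 = - (C + 1) by ring.
  by rewrite !WN => h; rewrite mulrC mulrNN h; ring.
- by move=> C; rewrite subrr W0; ring.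
- by move=> C; rewrite !addr0 W0 add0r sub0r WN W1; ring.
move=> m j; have [h _] := hv m j.
have WE (x : int) (n : nat) : x = n -> W x = even_factor s n * v n by move=> ->.
rewrite (WE (_ + _) (j + m.*2.+3)%N) 1?(WE (_ - _)%R j.+1); try lia.
rewrite (WE m.+1 m.+1) // (WE ((j + m).+2%:Z + 1) (j + m).+3); try lia.
rewrite (WE ((j + m).+2%:Z - 1) (j + m).+1) 1?(WE (_ + 1) m.+2); try lia.
rewrite (WE (_ - 1) m) 1?(WE (j + m).+2 (j + m).+2) //; try lia.
by rewrite mulrC h; ring.
Qed.

Lemma eds_addition_odd (K : comPzRingType) (s : K) (v : nat -> K) :
    let V := odd_ext v in
    v 0%N = 0 -> v 1%N = 1 -> v 2%N = 1 -> eds_addition s v ->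
  forall C D : int,
    V (C + D + 1) * V (C - D)
    = V D * V (D + 1) * (V (C - 1) * V (C + 2))
      - V (D - 1) * V (D + 2) * (V C * V (C + 1)).
Proof.
move=> V v0 v1 v2 hv.
have VN x : V (- x) = - V x by apply: odd_extN.
apply: (@reflection_ind 1) => //.
- move=> C D h; have -> : D - C = - (C - D) by ring.
  by rewrite VN mulrN [D + C]addrC h; ring.
- move=> C D h.
  have -> : - 1%N%:Z - C + D + 1 = - (C - D) by ring.
  have -> : - 1%N%:Z - C - D = - (C + D + 1) by ring.
  have -> : - 1%N%:Z - C - 1 = - (C + 2) by ring.
  have -> : - 1%N%:Z - C + 2 = - (C - 1) by ring.
  have -> : - 1%N%:Z - C + 1 = - C by ring.
  have -> : - 1%N%:Z - C = - (C + 1) by ring.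
  by rewrite !VN mulrC mulrNN h; ring.
- by move=> C; rewrite subrr [V 0]v0; ring.
- move=> C; rewrite !addr0 !add0r VN [V 0]v0 [V 1]v1 [V 2]v2; ring.
move=> m j; have [_ h] := hv m j.
have VE (x : int) (n : nat) : x = n -> V x = v n by move=> ->.
rewrite (VE (_ + _ + _) (j + m.*2.+4)%N) 1?(VE (_ - _) j.+1); try lia.
rewrite (VE m.+1 m.+1) // (VE ((j + m).+2%:Z - 1) (j + m).+1); try lia.
rewrite (VE ((j + m).+2%:Z + 2) (j + m).+4) 1?(VE (_ + 1) m.+2); try lia.
rewrite (VE (_ - 1) m) 1?(VE (j + m).+2 (j + m).+2) //; try lia.
rewrite (VE (_ + 2) m.+3) 1?(VE ((j + m).+2%:Z + 1) (j + m).+3); try lia.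
by rewrite mulrC h.
Qed.

(** * Bilateral Somos-4 sequences and the three-term identity *)

(** The defect [r] vanishes at 0 once [t 4] is eliminated; [integral_shift] carries this in both
    directions, as no term of [t] vanishes. *)
Lemma somos4_integral (F : fieldType) (alpha beta : F) (t : int -> F) :
    (forall n, t n != 0) -> somos4 alpha beta t ->
  forall n, t n * t (n + 3) ^+ 2 + t (n + 1) ^+ 2 * t (n + 4)
    + alpha * t (n + 2) ^+ 3
    = first_integral alpha beta t * t (n + 1) * t (n + 2) * t (n + 3).
Proof.
move=> t0 ht; set H := first_integral _ _ _.
pose r n := t n * t (n + 3) ^+ 2 + t (n + 1) ^+ 2 * t (n + 4)
    + alpha * t (n + 2) ^+ 3 - H * t (n + 1) * t (n + 2) * t (n + 3).
have shift n : t (n + 4) * r n = t (n + 1) * r (n + 1).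
  have addE k : n + 1 + k%:Z = n + k.+1%:Z by lia.
  have := ht (n + 1).
  rewrite /r !(addE 1%N, addE 2%N, addE 3%N, addE 4%N) => hn.
  exact: integral_shift (ht n) hn.
suff r0 n : r n = 0 by move=> n; apply/eqP; rewrite -subr_eq0 -/(r n) r0.
elim/int_rec: n => [|n IHn|n IHn].
- have t4 : t 4 = (alpha * t 1 * t 3 + beta * t 2 ^+ 2) / t 0.
    by rewrite -(ht 0) mulrC mulKf.
  rewrite /r !add0r t4 /H /first_integral; field.
  by rewrite !t0.
- apply: (mulfI (t0 (n + 1))); rewrite mulr0 -addn1 PoszD -shift IHn mulr0.
  by [].
have := shift (- n.+1%:Z); have -> : - n.+1%:Z + 1 = - n%:Z by lia.
by rewrite IHn mulr0 => /eqP; rewrite mulf_eq0 (negPf (t0 _)) => /eqP.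
Qed.

(** For m > 0 the sequence is restarted at index a - m. Negative m follows since the first formula
    is even in m and the second is invariant under m -> -1-m. *)
Lemma somos4_addition_int (F : fieldType) (s beta H : F) (t : int -> F)
    (v : nat -> F) :
    let V := odd_ext v in
    let W := odd_ext (fun k => even_factor s k * v k) in
    (forall n, t n != 0) -> somos4 (s ^+ 2) beta t ->
    (forall n, t n * t (n + 3) ^+ 2 + t (n + 1) ^+ 2 * t (n + 4)
      + s ^+ 2 * t (n + 2) ^+ 3 = H * t (n + 1) * t (n + 2) * t (n + 3)) ->
    v 0%N = 0 -> v 1%N = 1 -> v 2%N = 1 ->
    somos4_int (fun k => even_factor (s ^+ 2) k ^+ 2) beta H v ->
  forall a m : int,
    t (a - m) * t (a + m)
      = W m ^+ 2 * (t (a - 1) * t (a + 1)) - W (m - 1) * W (m + 1) * t a ^+ 2 /\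
    t (a - m) * t (a + m + 1)
      = V m * V (m + 1) * (t (a - 1) * t (a + 2))
        - V (m - 1) * V (m + 2) * (t a * t (a + 1)).
Proof.
move=> V W t0 ht hH v0 v1 v2 hv a.
have VN x : V (- x) = - V x by apply: odd_extN.
have WN x : W (- x) = - W x by apply: odd_extN; rewrite v0 mulr0.
have nat_case (m : nat) : t (a - m%:Z) * t (a + m%:Z)
      = W m ^+ 2 * (t (a - 1) * t (a + 1))
        - W (m%:Z - 1) * W (m%:Z + 1) * t a ^+ 2 /\
    t (a - m%:Z) * t (a + m%:Z + 1)
      = V m * V (m%:Z + 1) * (t (a - 1) * t (a + 2))
        - V (m%:Z - 1) * V (m%:Z + 2) * (t a * t (a + 1)).
  case: m => [|m].
    have -> : 0%N%:Z - 1 = - 1 by [].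
    have -> : 0%N%:Z + 1 = 1 by [].
    have -> : 0%N%:Z + 2 = 2 by [].
    rewrite VN WN subr0 ?addr0 /V /W /= v0 v1 v2 /even_factor /=.
    by split; ring.
  pose u (k : nat) := t (a - m.+1%:Z + k%:Z).
  have hu : somos4_int (fun=> s ^+ 2) beta H u.
    move=> k; rewrite /u; set n := a - m.+1%:Z + k%:Z.
    have E1 : a - m.+1%:Z + k.+1%:Z = n + 1 by rewrite /n; lia.
    have E2 : a - m.+1%:Z + k.+2%:Z = n + 2 by rewrite /n; lia.
    have E3 : a - m.+1%:Z + k.+3%:Z = n + 3 by rewrite /n; lia.
    have E4 : a - m.+1%:Z + k.+4%:Z = n + 4 by rewrite /n; lia.
    by rewrite E1 E2 E3 E4; split; [exact: ht|exact: hH].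
  have [] := somos4_addition (u := u) (fun k => t0 _) hu v0 v1 v2 hv m 0%N.
  have uE (k : nat) (x : int) : x = a - m.+1%:Z + k%:Z -> u k = t x.
    by move=> ->.
  rewrite (uE 0%N (a - m.+1%:Z)); try lia.
  rewrite !add0n (uE m.*2.+2 (a + m.+1%:Z)); try lia.
  rewrite (uE m.*2.+3 (a + m.+1%:Z + 1)); try lia.
  rewrite (uE m (a - 1)); try lia.
  rewrite (uE m.+1 a); try lia.
  rewrite (uE m.+2 (a + 1)); try lia.
  rewrite (uE m.+3 (a + 2)); try lia.
  move=> -> ->.
  have -> : m.+1%:Z - 1 = m by lia.
  have -> : m.+1%:Z + 1 = m.+2 by lia.
  have -> : m.+1%:Z + 2 = m.+3 by lia.
  split=> //; rewrite /W /= !even_factor_exp even_factorS2; ring.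
case=> m; first exact: nat_case.
have -> : Negz m = - m.+1%:Z by lia.
split.
  rewrite opprK; have [h _] := nat_case m.+1; rewrite mulrC h.
  have -> : - m.+1%:Z - 1 = - (m.+1%:Z + 1) by ring.
  have -> : - m.+1%:Z + 1 = - (m.+1%:Z - 1) by ring.
  by rewrite !WN; ring.
have [_ h] := nat_case m.
have -> : a - - m.+1%:Z = a + m%:Z + 1 by lia.
have -> : a - m.+1%:Z + 1 = a - m%:Z by lia.
have -> : - m.+1%:Z - 1 = - (m%:Z + 2) by lia.
have -> : - m.+1%:Z + 2 = - (m%:Z - 1) by lia.
have -> : - m.+1%:Z + 1 = - m%:Z by lia.
have -> : - m.+1%:Z = - (m%:Z + 1) by lia.
by rewrite mulrC h !VN; ring.
Qed.

(** The three products of [t] share their centre, so they are the values of one linear form on three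
    plane vectors, indexed by M, M-p, M-q. The products of W are the pairwise determinants of these
    vectors. *)
Lemma somos4_three_term (F : fieldType) (s beta H : F) (t : int -> F)
    (v : nat -> F) :
    let W := odd_ext (fun k => even_factor s k * v k) in
    (forall n, t n != 0) -> somos4 (s ^+ 2) beta t ->
    (forall n, t n * t (n + 3) ^+ 2 + t (n + 1) ^+ 2 * t (n + 4)
      + s ^+ 2 * t (n + 2) ^+ 3 = H * t (n + 1) * t (n + 2) * t (n + 3)) ->
    v 0%N = 0 -> v 1%N = 1 -> v 2%N = 1 ->
    somos4_int (fun k => even_factor (s ^+ 2) k ^+ 2) beta H v ->
    eds_addition s v ->
  forall N p q n : int,
  W (q - p) * W (N - p - q) * t n * t (n + N)
  = W q * W (N - q) * t (n + p) * t (n + N - p)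
    - W p * W (N - p) * t (n + q) * t (n + N - q).
Proof.
move=> W t0 ht hH v0 v1 v2 hv hadd N p q n.
have add_t := somos4_addition_int t0 ht hH v0 v1 v2 hv.
pose M := (N %/ 2)%Z.
have [NE|NE] : N = M + M \/ N = M + M + 1 by rewrite /M; lia.
  have add_W := eds_addition_even v0 v1 hadd.
  have T m : t (n + M - m) * t (n + M + m) = _ := (add_t (n + M) m).1.
  have WW C D x y : x = C - D -> y = C + D ->
      W x * W y = W D ^+ 2 * (W (C + 1) * W (C - 1))
        - W (D + 1) * W (D - 1) * W C ^+ 2.
    by move=> -> ->; rewrite mulrC add_W.
  rewrite -!mulrA (mulrA (W (q - p))) (mulrA (W q)) (mulrA (W p)).
  rewrite (WW (M - p) (M - q) (q - p)); [|lia|lia].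
  rewrite (WW M (M - q) q); [|lia|lia].
  rewrite (WW M (M - p) p); [|lia|lia].
  have := T M; have := T (M - p); have := T (M - q).
  have -> : n + M - M = n by lia.
  have -> : n + M + M = n + N by lia.
  have -> : n + M - (M - p) = n + p by lia.
  have -> : n + M + (M - p) = n + N - p by lia.
  have -> : n + M - (M - q) = n + q by lia.
  have -> : n + M + (M - q) = n + N - q by lia.
  move=> -> -> ->; rewrite -/W; ring.
pose V := odd_ext v.
have add_V := eds_addition_odd v0 v1 v2 hadd.
have T m : t (n + M - m) * t (n + M + m + 1) = _ := (add_t (n + M) m).2.
(* The indices have odd sum, so exactly one is even and contributes the factor [s], common to all
   three terms. *)
have WW C D x y : x = C - D -> y = C + D + 1 ->
    W x * W y = s * (V D * V (D + 1) * (V (C - 1) * V (C + 2))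
      - V (D - 1) * V (D + 2) * (V C * V (C + 1))).
  move=> -> ->; rewrite -add_V -/V /W !odd_ext_even_factor -/V.
  have es : odd (absz (C - D)%R + absz (C + D + 1)%R) by lia.
  by rewrite -[X in _ = X * _](even_factorM s es); ring.
rewrite -!mulrA (mulrA (W (q - p))) (mulrA (W q)) (mulrA (W p)).
rewrite (WW (M - p) (M - q) (q - p)); [|lia|lia].
rewrite (WW M (M - q) q); [|lia|lia].
rewrite (WW M (M - p) p); [|lia|lia].
have := T M; have := T (M - p); have := T (M - q).
have -> : n + M - M = n by lia.
have -> : n + M + M + 1 = n + N by lia.
have -> : n + M - (M - p) = n + p by lia.
have -> : n + M + (M - p) + 1 = n + N - p by lia.
have -> : n + M - (M - q) = n + q by lia.
have -> : n + M + (M - q) + 1 = n + N - q by lia.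
move=> -> -> ->; rewrite -/V; ring.
Qed.

(** * Lifting to polynomials and specialization *)

(** In the application [A] is the polynomial ring and [K] its fraction field. The integral relation
    is multiplied by [b] because H = (i - s^4)/b need not lie in [A]. *)
Lemma companion_lift (A : idomainType) (K : fieldType) (f : {rmorphism A -> K})
    (s b i : A) :
    let w := edseq_nat 1 (f s) (- f b) (- (f i * f s)) in
    injective f -> s != 0 -> b != 0 -> (forall k, w k.+1 != 0) ->
  exists q : nat -> A,
    [/\ q 0%N = 0, q 1%N = 1 & q 2%N = 1] /\
    [/\ forall k, f (even_factor s k * q k) = w k,
        eds_addition s q,
        forall k, q k * q k.+4
          = even_factor (s ^+ 2) k.+1 ^+ 2 * q k.+1 * q k.+3 + b * q k.+2 ^+ 2
      & forall k, b * (q k * q k.+3 ^+ 2 + q k.+1 ^+ 2 * q k.+4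
            + even_factor (s ^+ 2) k ^+ 2 * q k.+2 ^+ 3)
          = (i - s ^+ 4) * (q k.+1 * q k.+2 * q k.+3)].
Proof.
move=> w f_inj s0 b0 w0.
have f_neq0 x : x != 0 -> f x != 0.
  by apply: contra_neq => fx; apply: f_inj; rewrite fx rmorph0.
have [fs0 fb0] := (f_neq0 _ s0, f_neq0 _ b0).
pose v k := w k / even_factor (f s) k.
have wv k : w k = even_factor (f s) k * v k.
  by rewrite /v mulrC divfK // even_factor_neq0.
have [v_int v_add] := companion_somos4_int w0 fs0 fb0 wv.
have [v_0 v_1 v_2 v_3 v_4] :
    [/\ v 0%N = 0, v 1%N = 1, v 2%N = 1, v 3%N = - f b & v 4%N = - f i].
  by rewrite /v /w /even_factor /= mul0r !divr1 mulNr mulfK ?divff.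
have v_lift : forall k, exists P, f P = v k.
  apply: (eds_addition_integral v_add) => // -[|[|[|[|[|//]]]]] _.
  - by exists 0; rewrite rmorph0.
  - by exists 1; rewrite rmorph1.
  - by exists 1; rewrite rmorph1.
  - by exists (- b); rewrite rmorphN.
  - by exists (- i); rewrite rmorphN.
pose q k := epsilon (inhabits 0) (fun P => f P = v k).
have fq k : f (q k) = v k by exact: epsilon_spec (v_lift k).
exists q; split.
  by split; apply: f_inj; rewrite fq ?rmorph0 ?rmorph1.
split.
- by move=> k; rewrite rmorphM fq wv rmorph_even_factor.
- exact: eds_addition_inj f_inj fq v_add.
- move=> k; apply: f_inj.
  rewrite !(rmorphD, rmorphM, rmorphXn) /= !fq (v_int k).1.
  by rewrite -rmorphXn rmorph_even_factor.
move=> k; apply: f_inj; have := (v_int k).2.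
rewrite -rmorphXn rmorph_even_factor -!fq => h.
rewrite !(rmorphM, rmorphD, rmorphB, rmorphXn) /=.
by rewrite h; field.
Qed.

(* The first integral is obtained from [i = s ^+ 4 + b * H] only after division
   by [b], so [i] is replaced by this expression, with [H] an indeterminate,
   before specializing [b] to a value that may be zero. *)
Lemma companion_specialize (A : idomainType) (F : fieldType)
    (theta : {rmorphism A -> A}) (ev : {rmorphism A -> F}) (s b i : A)
    (q : nat -> A) :
    theta s = s -> theta b = b -> theta i = s ^+ 4 + b * i -> b != 0 ->
    eds_addition s q ->
    (forall k, q k * q k.+4
      = even_factor (s ^+ 2) k.+1 ^+ 2 * q k.+1 * q k.+3 + b * q k.+2 ^+ 2) ->
    (forall k, b * (q k * q k.+3 ^+ 2 + q k.+1 ^+ 2 * q k.+4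
        + even_factor (s ^+ 2) k ^+ 2 * q k.+2 ^+ 3)
      = (i - s ^+ 4) * (q k.+1 * q k.+2 * q k.+3)) ->
  let v k := ev (theta (q k)) in
  eds_addition (ev s) v /\
  somos4_int (fun k => even_factor (ev s ^+ 2) k ^+ 2) (ev b) (ev i) v.
Proof.
move=> ths thb thi b0 q_add q_somos q_int v.
pose g : {rmorphism A -> F} := ev \o theta.
have gs : g s = ev s by rewrite /g /= ths.
have thef k : theta (even_factor (s ^+ 2) k) = even_factor (s ^+ 2) k.
  by rewrite -rmorph_even_factor rmorphXn ths.
have evef k : ev (even_factor (s ^+ 2) k) = even_factor (ev s ^+ 2) k.
  by rewrite -rmorph_even_factor rmorphXn.
split; first by rewrite -gs; exact: (eds_addition_morph g q_add).
move=> k; split.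
  rewrite /v -evef -thef -[in ev b]thb -!rmorphM q_somos.
  by rewrite !(rmorphD, rmorphM, rmorphXn).
have := congr1 theta (q_int k).
rewrite !(rmorphXn, rmorphB, rmorphD, rmorphM) /=.
rewrite ths thb thi thef [s ^+ 4 + _ - _]addrAC subrr add0r -!mulrA.
move=> /(mulfI b0) /(congr1 ev).
by rewrite !(rmorphXn, rmorphD, rmorphM) /= evef !mulrA.
Qed.

Lemma companion_spec (F : numFieldType) (s b H : F) :
  exists v : nat -> F,
    [/\ v 0%N = 0, v 1%N = 1, v 2%N = 1 & eds_addition s v] /\
    somos4_int (fun k => even_factor (s ^+ 2) k ^+ 2) b H v /\
    forall (alpha : F) t, companion_I alpha b t = s ^+ 4 + b * H ->
    companion s alpha b t =1 odd_ext (fun k => even_factor s k * v k).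
Proof.
set X0 : {mpoly F[3]} := 'X_0; set X1 : {mpoly F[3]} := 'X_1.
set X2 : {mpoly F[3]} := 'X_2.
pose f : {rmorphism {mpoly F[3]} -> {fraction {mpoly F[3]}}} := @tofrac _.
have f_inj : injective f by move=> x y /eqP; rewrite tofrac_eq => /eqP.
have X_neq0 i : ('X_i : {mpoly F[3]}) != 0.
  apply/eqP => /(congr1 (meval (fun=> 1))) /eqP.
  by rewrite mevalXU meval0 oner_eq0.
pose w := edseq_nat 1 (f X0) (- f X1) (- (f X2 * f X0)).
have w0 : forall k, w k.+1 != 0.
  pose ev : {rmorphism {mpoly F[3]} -> F} := meval (tnth [tuple 2; - 3; - 2]).
  by apply: (edseq_nat_neq0 (ev := ev) f_inj); rewrite /ev /= mevalXU.
have [q [[q0 q1 q2] [qw q_add q_somos q_int]]] :=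
  companion_lift f_inj (X_neq0 _) (X_neq0 _) w0.
pose theta : {rmorphism {mpoly F[3]} -> {mpoly F[3]}} :=
  comp_mpoly [tuple X0; X1; X0 ^+ 4 + X1 * X2].
have [th0 th1 th2] :
    [/\ theta X0 = X0, theta X1 = X1 & theta X2 = X0 ^+ 4 + X1 * X2].
  by rewrite /theta /= !comp_mpolyXU.
pose ev : {rmorphism {mpoly F[3]} -> F} := meval (tnth [tuple s; b; H]).
have [ev0 ev1 ev2] : [/\ ev X0 = s, ev X1 = b & ev X2 = H].
  by rewrite /ev /= !mevalXU.
pose pt := tnth [tuple s; b; s ^+ 4 + b * H].
(* Substitution followed by evaluation at (s, b, H) is evaluation at the point defining the
   companion. *)
have evth P : ev (theta P) = P.@[pt].
  rewrite /ev /theta /= comp_mpoly_meval; apply: meval_eq.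
  case=> -[|[|[|//]]] lt_i; rewrite /pt !(tnth_nth 0) /= ?mevalXU //.
  by rewrite !(mevalD, mevalM, rmorphXn) /= !mevalXU.
have [v_add v_int] :=
  companion_specialize ev th0 th1 th2 (X_neq0 _) q_add q_somos q_int.
rewrite ev0 ev1 ev2 in v_add v_int.
exists (fun k => ev (theta (q k))); split.
  by rewrite q0 q1 q2 !rmorph0 !rmorph1.
split=> // alpha t It x; rewrite /companion It -/pt.
(* Injectivity of [tofrac] identifies the polynomial chosen by [epsilon] with any explicit
   representative. *)
have polyE P : f P = generic_companion F x -> companion_poly F x = P.
  move=> fP; apply: f_inj; rewrite fP.
  by apply: (epsilon_spec (inhabits 0) (fun P => tofrac P = _)); exists P.
have qE k : (even_factor X0 k * q k).@[pt] = even_factor s k * ev (theta (q k)).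
  by rewrite -evth !rmorphM -!rmorph_even_factor th0 ev0.
case: x polyE => k polyE /=.
  rewrite (polyE (even_factor X0 k * q k)) ?qE // qw /generic_companion /=.
  by rewrite /w !rmorphN rmorphM.
rewrite (polyE (- (even_factor X0 k.+1 * q k.+1))) ?mevalN ?qE //.
by rewrite rmorphN qw /generic_companion /w /= !rmorphN rmorphM.
Qed.

(** * The identity for complex Somos-4 sequences *)

Theorem theorem5p1 (R : realType) (alpha beta sqrt_alpha : R[i])
    (t : int -> R[i])
    (t_neq0 : forall n : int, t n != 0)
    (t_somos : somos4 alpha beta t)
    (sqrt_alphaE : sqrt_alpha ^+ 2 = alpha)
    (N p q n : int) :
  let W := companion sqrt_alpha alpha beta t in
  W (q - p) * W (N - p - q) * t n * t (n + N)
  = W q * W (N - q) * t (n + p) * t (n + N - p)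
    - W p * W (N - p) * t (n + q) * t (n + N - q).
Proof.
subst alpha.
have [v [[v0 v1 v2 v_add] [v_int WE]]] :=
  companion_spec sqrt_alpha beta (first_integral (sqrt_alpha ^+ 2) beta t).
have t_int := somos4_integral t_neq0 t_somos.
have IE : companion_I (sqrt_alpha ^+ 2) beta t
    = sqrt_alpha ^+ 4 + beta * first_integral (sqrt_alpha ^+ 2) beta t.
  by rewrite /companion_I -exprM.
move=> W; rewrite /W !(WE _ _ IE).
exact: somos4_three_term t_neq0 t_somos t_int v0 v1 v2 v_int v_add N p q n.
Qed.
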